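(* There exist universal constants $c,d>0$ such that for every $n\in\mathbb{N}$ and all continuous matrix functions $A:\mathbb{R}\to M_{n\times n}$ with the property that $\|A(t)e_i\|=1$ for all $t\in\mathbb{R}$ and $1\le i\le n$, there exists a continuous family of $m$-dimensional subspaces $\{U(t)\}_{t\in\mathbb{R}}$ of $\mathbb{R}^n$ with $m\ge dn/\Lambda^4$, where $\Lambda=\sup_{t\in\mathbb{R}}\|A(t)\|$, such that $\|A(t)v\|\ge c\|v\|$ for every $t\in\mathbb{R}$ and every $v\in U(t)$. Furthermore, each subspace $U(t)$ is a quadratic convex combination of disjoint basis vectors.
   Context: $M_{n\times n}$ denotes the space of real $n\times n$ matrices; $e_1,\dots,e_n$ is the standard basis of $\mathbb{R}^n$; $\|\cdot\|$ on vectors is the Euclidean norm and on matrices the operator norm. A matrix function is continuous if its entries are continuous. A family $\{U(t)\}_{t\in\mathbb{R}}$ of subspaces of $\mathbb{R}^n$ is continuous if the function $t\mapsto P(t)\in M_{n\times n}$, where $P(t)$ is the orthogonal projection onto $U(t)$, is continuous. An $m$-dimensional subspace $U$ of $\mathbb{R}^n$ is called a quadratic convex combination of disjoint basis vectors if there exist disjoint subsets $\sigma_1=\{i_1<\cdots<i_m\}$, $\sigma_2=\{j_1<\cdots<j_m\}$ of $\{1,\dots,n\}$ and $\lambda\in[0,1]$ such that $U$ is spanned by the orthonormal sequence $u_k=\lambda^{1/2}e_{i_k}+(1-\lambda)^{1/2}e_{j_k}$, $k=1,\dots,m$.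
   Formalization: The final claim, that each U(t) is a quadratic convex combination of disjoint basis vectors, is asserted only for n ≠ 1: for n = 1 the bound forces m = 1, but {1} has no two disjoint one-element subsets. *)

(* Defs.v *)
From mathcomp Require Import all_boot all_order all_algebra.
From mathcomp Require Import all_classical all_reals all_analysis.
Import Order.TTheory GRing.Theory Num.Theory.
Import numFieldNormedType.Exports.

Set Implicit Arguments.
Unset Strict Implicit.
Unset Printing Implicit Defensive.

Local Open Scope classical_set_scope.
Local Open Scope ring_scope.

Definition dotv (R : realType) (n : nat) (u v : 'cV[R]_n) : R :=
  \sum_(i < n) u i 0 * v i 0.

(* The norm that the library puts on matrices is the sup norm, hence the
   separate Euclidean norm and operator norm. *)
Definition enorm (R : realType) (n : nat) (v : 'cV[R]_n) : R :=
  Num.sqrt (dotv v v).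

Definition opnorm (R : realType) (n : nat) (A : 'M[R]_n) : R :=
  sup [set enorm (A *m v) | v in [set v : 'cV[R]_n | enorm v <= 1]].

Definition basis_vec (R : realType) (n : nat) (i : 'I_n) : 'cV[R]_n :=
  delta_mx i 0.
Arguments basis_vec R {n} i.

Definition mx_continuous (R : realType) (n : nat) (A : R -> 'M[R]_n) : Prop :=
  forall i j : 'I_n, continuous (fun t : R => A t i j).

(* The supremum is taken in the extended reals: A may be unbounded. *)
Definition sup_opnorm (R : realType) (n : nat) (A : R -> 'M[R]_n) : \bar R :=
  ereal_sup (range (fun t : R => (opnorm (A t))%:E)).

(* P v is the unique element of U such that v - P v is orthogonal to U, so
   this predicate determines the matrix P. *)
Definition is_orth_proj (R : realType) (n : nat)
    (U : {vspace 'cV[R]_n}) (P : 'M[R]_n) : Prop :=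
  forall v : 'cV[R]_n,
    P *m v \in U /\ (forall u, u \in U -> dotv u (v - P *m v) = 0).

Definition continuous_family (R : realType) (n : nat)
    (U : R -> {vspace 'cV[R]_n}) : Prop :=
  exists P : R -> 'M[R]_n,
    (forall t, is_orth_proj (U t) (P t)) /\ mx_continuous P.

(* The sets {i_1 < ... < i_m} and {j_1 < ... < j_m} are given by their
   increasing enumerations s1 and s2. Being disjoint, they force m + m <= n;
   in particular R^1 has no such subspace with m = 1. *)
Definition quad_convex_comb (R : realType) (n m : nat)
    (U : {vspace 'cV[R]_n}) : Prop :=
  exists (s1 s2 : 'I_m -> 'I_n) (lambda : R),
    [/\ {homo s1 : k l / (k < l)%N}, {homo s2 : k l / (k < l)%N},
        (forall k l, s1 k != s2 l),
        0 <= lambda <= 1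
      & U = <<[seq (Num.sqrt lambda *: basis_vec R (s1 k)
                    + Num.sqrt (1 - lambda) *: basis_vec R (s2 k))%R
              | k : 'I_m]>>%VS].

(* Main.v *)
Require Import Defs.
From mathcomp Require Import all_boot all_order all_algebra.
From mathcomp Require Import all_classical all_reals all_analysis.
From mathcomp Require Import ring lra.
Import Order.TTheory GRing.Theory Num.Theory.
Import numFieldNormedType.Exports.
Local Open Scope ring_scope.

Set Implicit Arguments.
Unset Strict Implicit.
Unset Printing Implicit Defensive.

(** Fix a time and let [w_j] be the unit columns of [A], so that
    [\sum_j <w_j, x>^2 <= L |x|^2] with [L = Lambda^2].  Suppose that [m] is at
    most a small multiple of [n / L] and that the columns indexed by [s1] are
    well conditioned.  Choose the columns [s2] greedily: with [Q] the projection
    onto the span of the columns of [s1] and those already chosen, split a new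
    column as [w_j = p_j + q_j], [q_j = Q w_j].  The [p_j] are mutually orthogonal
    and orthogonal to the range of [A] on [s1], so everything reduces to keeping
    the norm of [(q_j)] small.  This is done with an upper barrier [u] for
    [M = \sum_j q_j q_j^T] in the style of Batson, Spielman and Srivastava: the
    potential [\sum_i <Q w_i, (u - M)^-1 Q w_i>] hardly grows when [u] increases
    by a multiple of [L / n] and the new index is chosen by averaging.  As the
    columns of [s2] are then nearly orthogonal to the range of [A] on [s1], every
    quadratic convex combination of [s1] and [s2] is well conditioned as well.

    By continuity, a well conditioned set stays so for a short time, during which
    one moves from [s1] to a fresh [s2]; a supremum argument covers each interval
    [[k, k + 1]], and the resulting paths are concatenated over the line. *)

(** * Inner products and positive definite forms *)

Section Dot.
Variable R : realType.
Implicit Types n m k : nat.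

Lemma dotvE n (u v : 'cV[R]_n) : dotv u v = (u^T *m v) 0 0.
Proof. by rewrite mxE; apply: eq_bigr => i _; rewrite mxE. Qed.

Lemma dotvC n (u v : 'cV[R]_n) : dotv u v = dotv v u.
Proof. by apply: eq_bigr => i _; rewrite mulrC. Qed.

Lemma dotvDl n (u v w : 'cV[R]_n) : dotv (u + v) w = dotv u w + dotv v w.
Proof. by rewrite -big_split; apply: eq_bigr => i _; rewrite mxE mulrDl. Qed.

Lemma dotvZl n a (u w : 'cV[R]_n) : dotv (a *: u) w = a * dotv u w.
Proof. by rewrite mulr_sumr; apply: eq_bigr => i _; rewrite mxE mulrA. Qed.

Lemma dotvDr n (u v w : 'cV[R]_n) : dotv w (u + v) = dotv w u + dotv w v.
Proof. by rewrite dotvC dotvDl !(dotvC w). Qed.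

Lemma dotvZr n a (u w : 'cV[R]_n) : dotv w (a *: u) = a * dotv w u.
Proof. by rewrite dotvC dotvZl dotvC. Qed.

Lemma dotvNl n (u w : 'cV[R]_n) : dotv (- u) w = - dotv u w.
Proof. by rewrite -scaleN1r dotvZl mulN1r. Qed.

Lemma dotvNr n (u w : 'cV[R]_n) : dotv w (- u) = - dotv w u.
Proof. by rewrite dotvC dotvNl dotvC. Qed.

Lemma dotv0l n (u : 'cV[R]_n) : dotv 0 u = 0.
Proof. by rewrite /dotv big1 // => i _; rewrite mxE mul0r. Qed.

Lemma dotv0r n (u : 'cV[R]_n) : dotv u 0 = 0.
Proof. by rewrite dotvC dotv0l. Qed.

Definition dotv_lin := (dotvDl, dotvDr, dotvNl, dotvNr, dotvZl, dotvZr, dotv0l, dotv0r).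

Lemma dotv_suml n (I : Type) (r : seq I) (P : pred I) (F : I -> 'cV[R]_n) u :
  dotv (\sum_(i <- r | P i) F i) u = \sum_(i <- r | P i) dotv (F i) u.
Proof. by apply: (big_morph (fun x => dotv x u)) => [x y|]; rewrite ?dotvDl ?dotv0l. Qed.

Lemma dotv_sumr n (I : Type) (r : seq I) (P : pred I) (F : I -> 'cV[R]_n) u :
  dotv u (\sum_(i <- r | P i) F i) = \sum_(i <- r | P i) dotv u (F i).
Proof. by rewrite dotvC dotv_suml; apply: eq_bigr => i _; rewrite dotvC. Qed.

Lemma dotv_mull n k (B : 'M[R]_(n, k)) u v : dotv (B *m u) v = dotv u (B^T *m v).
Proof. by rewrite !dotvE trmx_mul -mulmxA. Qed.

Lemma dotv_ge0 n (u : 'cV[R]_n) : 0 <= dotv u u.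
Proof. by apply: sumr_ge0 => i _; rewrite -expr2 sqr_ge0. Qed.

Lemma dotv_eq0 n (u : 'cV[R]_n) : (dotv u u == 0) = (u == 0).
Proof.
rewrite /dotv psumr_eq0; last by move=> i _; rewrite -expr2 sqr_ge0.
apply/idP/eqP => [/allP h|->]; last by apply/allP => i _; rewrite mxE mul0r eqxx.
apply/colP => i; rewrite mxE; apply/eqP.
by have := h i (mem_index_enum _); rewrite -expr2 sqrf_eq0.
Qed.

Lemma dotv_gt0 n (u : 'cV[R]_n) : u != 0 -> 0 < dotv u u.
Proof. by move=> u0; rewrite lt_def dotv_eq0 u0 dotv_ge0. Qed.

Definition posdef n (U : 'M[R]_n) :=
  U^T = U /\ forall x : 'cV[R]_n, x != 0 -> 0 < dotv x (U *m x).

Lemma posdef_ge0 n (U : 'M[R]_n) x : posdef U -> 0 <= dotv x (U *m x).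
Proof.
case=> _ h; have [->|/h/ltW //] := eqVneq x 0.
by rewrite dotv0l.
Qed.

Lemma posdef1 n : posdef (1%:M : 'M[R]_n).
Proof.
by split=> [|x x0]; [rewrite trmx1 | rewrite mul1mx dotv_gt0].
Qed.

Lemma posdefD n (U V : 'M[R]_n) :
  posdef U -> V^T = V -> (forall x, 0 <= dotv x (V *m x)) -> posdef (U + V).
Proof.
move=> [Us Up] Vs Vp; split=> [|x x0]; first by rewrite linearD /= Us Vs.
by rewrite mulmxDl dotvDr ltr_wpDr ?Up.
Qed.

Lemma posdef_unit n (U : 'M[R]_n) : posdef U -> U \in unitmx.
Proof.
move=> [Us Up]; rewrite -row_free_unit -kermx_eq0.
apply/eqP/row_matrixP => i; rewrite row0.
have hK : row i (kermx U) *m U = 0 by rewrite -row_mul mulmx_ker row0.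
apply/eqP/contraT => h0.
have x0 : (row i (kermx U))^T != 0 by apply: contra h0 => /eqP h; rewrite -[row _ _]trmxK h trmx0.
by have := Up _ x0; rewrite dotvE trmxK mulmxA hK mul0mx mxE ltxx.
Qed.

Lemma posdef_inv n (U : 'M[R]_n) : posdef U -> posdef (invmx U).
Proof.
move=> pU; have uU := posdef_unit pU; have [Us Up] := pU.
have Ws : (invmx U)^T = invmx U by rewrite trmx_inv Us.
split=> // x x0.
have y0 : invmx U *m x != 0.
  by apply: contra x0 => /eqP h; rewrite -[x](mulKVmx uU) h mulmx0.
by have := Up _ y0; rewrite dotv_mull Ws mulKVmx // mulmxA mulVmx // mul1mx.
Qed.

Lemma posdef_cauchy n (U : 'M[R]_n) x y : posdef U ->
  dotv x (U *m y) ^+ 2 <= dotv x (U *m x) * dotv y (U *m y).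
Proof.
move=> pU; have [Us Up] := pU.
have [->|y0] := eqVneq y 0; first by rewrite mulmx0 !dotv_lin expr0n mulr0.
have yp := Up _ y0; set b := dotv y _ in yp *.
have yx : dotv y (U *m x) = dotv x (U *m y) by rewrite dotvC dotv_mull Us.
set e := dotv x (U *m y).
have := posdef_ge0 (b *: x - e *: y) pU.
rewrite mulmxBr -!scalemxAr !dotv_lin yx -/b -/e.
set a := dotv x (U *m x) => h.
have : 0 <= b * (a * b - e ^+ 2) by move: h; congr (_ <= _); ring.
by rewrite pmulr_rge0 // subr_ge0.
Qed.

Lemma dotv_cauchy n (x y : 'cV[R]_n) : dotv x y ^+ 2 <= dotv x x * dotv y y.
Proof. by have := posdef_cauchy x y (posdef1 n); rewrite !mul1mx. Qed.

Lemma enorm_ge0 n (v : 'cV[R]_n) : 0 <= enorm v.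
Proof. exact: sqrtr_ge0. Qed.

Lemma enorm_sqr n (v : 'cV[R]_n) : enorm v ^+ 2 = dotv v v.
Proof. by rewrite sqr_sqrtr ?dotv_ge0. Qed.

Lemma enormZ n a (v : 'cV[R]_n) : enorm (a *: v) = `|a| * enorm v.
Proof.
by rewrite /enorm dotvZl dotvZr mulrA -expr2 sqrtrM ?sqr_ge0 // sqrtr_sqr.
Qed.

Lemma enorm_le n k (u : 'cV[R]_n) (v : 'cV[R]_k) c : 0 <= c ->
  (enorm u <= c * enorm v) = (dotv u u <= c ^+ 2 * dotv v v).
Proof.
move=> c0; rewrite -!enorm_sqr -exprMn ler_sqr ?nnegrE ?enorm_ge0 //.
by rewrite mulr_ge0 ?enorm_ge0.
Qed.

Lemma enorm_ge n k (u : 'cV[R]_n) (v : 'cV[R]_k) c : 0 <= c ->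
  (c * enorm v <= enorm u) = (c ^+ 2 * dotv v v <= dotv u u).
Proof.
move=> c0; rewrite -!enorm_sqr -exprMn ler_sqr ?nnegrE ?enorm_ge0 //.
by rewrite mulr_ge0 ?enorm_ge0.
Qed.

Lemma enormD n (u v : 'cV[R]_n) : enorm (u + v) <= enorm u + enorm v.
Proof.
rewrite -(@ler_pXn2r _ 2) ?nnegrE ?addr_ge0 ?enorm_ge0 // sqrrD !enorm_sqr.
rewrite !dotv_lin (dotvC v u).
suff : dotv u v <= enorm u * enorm v by lra.
apply: le_trans (ler_norm _) _.
rewrite -(@ler_pXn2r _ 2) ?nnegrE ?mulr_ge0 ?enorm_ge0 //.
by rewrite exprMn !enorm_sqr real_normK ?num_real // dotv_cauchy.
Qed.

Lemma enormN n (u : 'cV[R]_n) : enorm (- u) = enorm u.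
Proof. by rewrite -scaleN1r enormZ normrN1 mul1r. Qed.

End Dot.

(** * The barrier argument *)

Section Barrier.
Variables (R : realType) (k : nat).
Implicit Types (U : 'M[R]_k) (x y q : 'cV[R]_k).

Definition outer q : 'M[R]_k := q *m q^T.

Lemma outer_mul q x : outer q *m x = dotv q x *: q.
Proof.
by rewrite -mulmxA [q^T *m x]mx11_scalar mul_mx_scalar dotvE.
Qed.

Lemma outer_tr q : (outer q)^T = outer q.
Proof. by rewrite /outer trmx_mul trmxK. Qed.

Lemma posdef_shift U (d : R) : posdef U -> 0 <= d -> posdef (U + d%:M).
Proof.
move=> pU d0; apply: posdefD => // [|x]; first by rewrite tr_scalar_mx.
by rewrite mul_scalar_mx dotvZr mulr_ge0 ?dotv_ge0.
Qed.

(** With [q = U y + d y] the right side equals [d |y|^2 + d^2 <y, U^-1 y>], and the last term is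
    nonnegative. *)
Lemma inv_form_shift U (d : R) q y : posdef U -> 0 <= d ->
  y = invmx (U + d%:M) *m q ->
  d * dotv y y <= dotv q (invmx U *m q) - dotv q y.
Proof.
move=> pU d0 yE; have pV := posdef_shift pU d0.
have uU := posdef_unit pU; have uV := posdef_unit pV.
have qE : q = U *m y + d *: y.
  by rewrite -[LHS](mulKVmx uV) -yE mulmxDl mul_scalar_mx.
have WU z : invmx U *m (U *m z) = z by rewrite mulKmx.
have Ws : (invmx U)^T = invmx U by have [] := posdef_inv pU.
rewrite qE mulmxDr WU -scalemxAr !dotv_lin.
have -> : dotv (U *m y) (invmx U *m y) = dotv y y.
  by rewrite dotvC dotv_mull Ws WU.
have := posdef_ge0 y (posdef_inv pU).
rewrite -subr_ge0; set a := dotv y y; set b := dotv _ (invmx U *m y).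
set c := dotv (U *m y) y => hb.
have := mulr_ge0 (mulr_ge0 d0 d0) hb; have := mulr_ge0 d0 (dotv_ge0 y : 0 <= a).
lra.
Qed.

(** Cauchy-Schwarz for the form [U] gives [<q, x>^2 <= <q, U^-1 q> <x, U x>], and the first factor
    is below 1. *)
Lemma posdef_sub_outer U q : posdef U -> dotv q (invmx U *m q) < 1 ->
  posdef (U - outer q).
Proof.
move=> pU a1; have [Us Up] := pU; split=> [|x x0].
  by rewrite linearB /= Us outer_tr.
rewrite mulmxBl outer_mul !dotv_lin (dotvC x q).
have := posdef_cauchy (invmx U *m q) x pU.
rewrite mulKVmx ?posdef_unit // dotvC.
have -> : dotv (U *m x) (invmx U *m q) = dotv q x.
  have [Ws _] := posdef_inv pU.
  by rewrite dotvC dotv_mull Ws mulKmx ?posdef_unit.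
rewrite expr2 (dotvC _ q).
have xp := Up _ x0; nra.
Qed.

(** The Sherman-Morrison formula, read as a quadratic form. *)
Lemma inv_form_sub_outer U q x : posdef U -> dotv q (invmx U *m q) < 1 ->
  dotv x (invmx (U - outer q) *m x) =
  dotv x (invmx U *m x) +
    dotv x (invmx U *m q) ^+ 2 / (1 - dotv q (invmx U *m q)).
Proof.
move=> pU a1; set a := dotv q _ in a1 *; set W := invmx U.
have uU := posdef_unit pU; have [Ws _] := posdef_inv pU.
have uV := posdef_unit (posdef_sub_outer pU a1).
have a1' : 1 - a != 0 by rewrite gt_eqF ?subr_gt0.
have sym : dotv q (W *m x) = dotv x (W *m q).
  by rewrite dotvC dotv_mull Ws.
suff -> : invmx (U - outer q) *m x
    = W *m x + (dotv x (W *m q) / (1 - a)) *: (W *m q).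
  by rewrite !dotv_lin; field.
apply: (can_inj (mulKmx uV)); rewrite mulKVmx // mulmxBl outer_mul mulmxDr.
rewrite -scalemxAr !mulKVmx // !dotv_lin -/a sym.
set b := dotv x _.
rewrite -addrA -scalerBl (_ : _ - _ = 0) ?scale0r ?addr0 //.
by field.
Qed.

End Barrier.

(** * Orthogonal projections and their rank-one extensions *)

Section Projector.
Variables (R : realType) (k : nat).
Implicit Types (Q : 'M[R]_k) (x y p : 'cV[R]_k).

Definition projector Q := Q^T = Q /\ Q *m Q = Q.

Lemma projector_dotv Q x y : projector Q -> dotv (Q *m x) y = dotv x (Q *m y).
Proof. by case=> Qs _; rewrite dotv_mull Qs. Qed.

Lemma projector_le Q x : projector Q -> dotv (Q *m x) (Q *m x) <= dotv x x.
Proof.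
move=> pQ; have := dotv_ge0 (x - Q *m x).
rewrite !dotv_lin !projector_dotv // mulmxA pQ.2.
lra.
Qed.

Definition extend_proj Q p := Q + (dotv p p)^-1 *: outer p.

Lemma extend_proj_mul Q p x :
  extend_proj Q p *m x = Q *m x + (dotv p x / dotv p p) *: p.
Proof. by rewrite mulmxDl -scalemxAl outer_mul scalerA mulrC. Qed.

Lemma projector_extend Q p : projector Q -> Q *m p = 0 -> p != 0 ->
  projector (extend_proj Q p).
Proof.
move=> [Qs QQ] Qp p0; have pp : dotv p p != 0 by rewrite dotv_eq0.
split; first by rewrite linearD linearZ /= Qs outer_tr.
have Qo : Q *m outer p = 0 by rewrite mulmxA Qp mul0mx.
have oQ : outer p *m Q = 0.
  by apply: trmx_inj; rewrite trmx_mul outer_tr Qs Qo trmx0.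
rewrite mulmxDl !mulmxDr -!scalemxAl -!scalemxAr QQ Qo oQ !scaler0 addr0 add0r.
rewrite {2}/outer mulmxA outer_mul -scalemxAl scalerA mulVf // scale1r //.
Qed.

End Projector.

(** * Greedy selection of vectors under the barrier *)

Section Selection.
Variables (R : realType) (k n : nat) (w : 'I_n -> 'cV[R]_k) (L : R).
Hypothesis L0 : 0 <= L.
Hypothesis bessel : forall x, \sum_i dotv (w i) x ^+ 2 <= L * dotv x x.
Hypothesis unit_w : forall i, dotv (w i) (w i) = 1.
Implicit Types (Q U : 'M[R]_k) (x y p : 'cV[R]_k) (T : {set 'I_n}).

Definition potential Q U := \sum_i dotv (Q *m w i) (invmx U *m (Q *m w i)).

(** Raising the barrier by [d] lowers the potential by [D], and the rank-one term of [j] raises it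
    by [b j / (1 - a j)]. Summed over all [j], [a j + b j / D] is at most [psi + L / d], less than
    the number of indices outside [T], so some admissible [j] keeps it below 1. *)
Lemma potential_choice Q U (d psi : R) T :
  projector Q -> posdef U -> 0 < d -> potential Q U <= psi ->
  psi + L / d + #|T|%:R < n%:R ->
  exists j, [/\ j \notin T,
    posdef (U + d%:M - outer (Q *m w j)) &
    potential Q (U + d%:M - outer (Q *m w j)) <= potential Q U].
Proof.
move=> pQ pU d0 hpsi hT.
set V := U + d%:M; have pV : posdef V by apply: posdef_shift => //; exact: ltW.
pose a j := dotv (Q *m w j) (invmx V *m (Q *m w j)).
pose b j := \sum_i dotv (Q *m w i) (invmx V *m (Q *m w j)) ^+ 2.
pose D := potential Q U - potential Q V.
(* The index [j] is admissible as soon as [a j + b j / D < 1].  If [D = 0] then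
   all [b j] vanish, so the junk value [b j / 0 = 0] is harmless. *)
have a_ge0 j : 0 <= a j by apply: posdef_ge0; exact: posdef_inv.
have b_ge0 j : 0 <= b j by apply: sumr_ge0 => i _; exact: sqr_ge0.
have drop : d * (\sum_j dotv (invmx V *m (Q *m w j)) (invmx V *m (Q *m w j))) <= D.
  rewrite mulr_sumr /D /potential -sumrB; apply: ler_sum => j _.
  exact: inv_form_shift (ltW d0) _.
have D0 : 0 <= D.
  by apply: le_trans drop; rewrite mulr_ge0 ?(ltW d0) // sumr_ge0 // => j _; exact: dotv_ge0.
(* For fixed [j] the sum over [i] is a Bessel sum at [Q y], so [b j <= L |y|^2]; [drop] bounds the
   sum of these [|y|^2] by [D / d]. *)
have sum_b : \sum_j b j <= L / d * D.
  rewrite -mulrA; apply: (@le_trans _ _ (L * \sum_j dotv (invmx V *m (Q *m w j)) (invmx V *m (Q *m w j)))).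
    rewrite mulr_sumr; apply: ler_sum => j _.
    set y := invmx V *m _.
    apply: (@le_trans _ _ (L * dotv (Q *m y) (Q *m y))); last first.
      by rewrite ler_wpM2l // projector_le.
    rewrite /b; under eq_bigr => i _ do rewrite projector_dotv //.
    exact: bessel.
  by rewrite ler_wpM2l // ler_pdivlMl.
have sum_bD : \sum_j b j / D <= L / d.
  rewrite -mulr_suml; have [->|Dn0] := eqVneq D 0.
    by rewrite invr0 mulr0 divr_ge0 // ltW.
  by rewrite ler_pdivrMr // lt_def Dn0.
have sum_a : \sum_j a j <= psi.
  by apply: le_trans hpsi; rewrite -subr_ge0.
have [j jT hj] : exists2 j, j \notin T & a j + b j / D < 1.
  apply: contrapT => hne.
  have : \sum_j (a j + b j / D) < \sum_(j | j \notin T) 1.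
    rewrite big_split /= sumr_const.
    have -> : #|[pred j | j \notin T]| = #|~: T| by apply: eq_card => j; rewrite !inE.
    have : (#|T| + #|~: T|)%:R = n%:R :> R by rewrite cardsC card_ord.
    rewrite natrD => cT.
    lra.
  apply/negP; rewrite -leNgt.
  apply: (@le_trans _ _ (\sum_(j | j \notin T) (a j + b j / D))).
    apply: ler_sum => j jT; rewrite leNgt; apply/negP => h.
    by apply: hne; exists j.
  rewrite [leRHS](bigID [pred j | j \notin T]) /= lerDl sumr_ge0 // => j _.
  by rewrite addr_ge0 // divr_ge0.
have a1 : a j < 1.
  by apply: le_lt_trans hj; rewrite lerDl divr_ge0.
exists j; split=> //; first exact: posdef_sub_outer.
rewrite -subr_ge0 /potential.
under [X in _ - X]eq_bigr => i _ do rewrite inv_form_sub_outer //.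
rewrite big_split /= -mulr_suml -/(b j) -/(a j) -/(potential Q V) opprD addrA -/D.
rewrite subr_ge0 ler_pdivrMr ?subr_gt0 //.
have [DE|Dn0] := eqVneq D 0.
  move: sum_b; rewrite DE mulr0 mul0r => sb.
  by apply: le_trans sb; rewrite (bigD1 j) //= lerDl sumr_ge0.
have Dp : 0 < D by rewrite lt_def Dn0.
rewrite -ler_pdivrMl // mulrC; lra.
Qed.

(** As [p] is an eigenvector of [V] orthogonal to the range of [Q], the cross terms vanish and the
    increase is a Bessel sum at [p] divided by [u |p|^2]. *)
Lemma potential_extend Q V p (u : R) : projector Q -> posdef V -> 0 < u ->
  Q *m p = 0 -> p != 0 -> V *m p = u *: p ->
  potential (extend_proj Q p) V <= potential Q V + L / u.
Proof.
move=> pQ pV u0 Qp p0 Vp; have un0 : u != 0 by rewrite gt_eqF.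
have pp : 0 < dotv p p by exact: dotv_gt0.
have Wp : invmx V *m p = u^-1 *: p.
  apply: (can_inj (mulKmx (posdef_unit pV))).
  by rewrite mulKVmx ?posdef_unit // -scalemxAr Vp scalerA mulVf // scale1r.
have [Ws _] := posdef_inv pV.
have -> : potential (extend_proj Q p) V =
    potential Q V + (\sum_i dotv (w i) p ^+ 2) / (dotv p p * u).
  rewrite /potential mulr_suml -big_split; apply: eq_bigr => i _ /=.
  rewrite extend_proj_mul mulmxDr -scalemxAr Wp !dotv_lin.
  have -> : dotv p (invmx V *m (Q *m w i)) = 0.
    by rewrite dotvC dotv_mull Ws Wp dotvZr projector_dotv // Qp dotv0r mulr0.
  rewrite (projector_dotv _ p pQ) Qp dotv0r (dotvC p (w i)).
  by field; rewrite un0 gt_eqF.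
rewrite lerD2l ler_pdivrMr ?mulr_gt0 //.
apply: le_trans (bessel p) _.
by rewrite [dotv p p * u]mulrC mulrA divfK.
Qed.

Variables (T : {set 'I_n}) (Q0 : 'M[R]_k) (u0 d psi0 : R) (N : nat).
Hypothesis proj0 : projector Q0.
Hypothesis u0_gt0 : 0 < u0.
Hypothesis d_gt0 : 0 < d.
Hypothesis hpsi0 : \sum_i dotv (Q0 *m w i) (Q0 *m w i) <= u0 * psi0.
Hypothesis room : psi0 + N%:R * (L / u0) + L / d + #|T|%:R + N%:R <= n%:R.
Hypothesis small : u0 + N%:R * d < 1.

(* [q j] is the projection of [w j] onto the span at the moment [j] was chosen, so
   that [w j - q j] is the new direction that [j] adds to the range of [Q]. *)
Record selected (r : nat) (tau : {set 'I_n}) (Q : 'M[R]_k) (q : 'I_n -> 'cV[R]_k) : Prop :=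
  Selected {
    sel_card : #|tau| = r;
    sel_disj : forall j, j \in tau -> j \notin T;
    sel_proj : projector Q;
    sel_absorb : Q *m Q0 = Q0;
    sel_q : forall j, j \in tau -> Q *m q j = q j;
    sel_w : forall j, j \in tau -> Q *m w j = w j;
    sel_p0 : forall j, j \in tau -> Q0 *m (w j - q j) = 0;
    sel_pq : forall j, j \in tau -> dotv (w j - q j) (q j) = 0;
    sel_orth : forall i j, i \in tau -> j \in tau -> i != j ->
      dotv (w i - q i) (w j - q j) = 0;
    sel_posdef : posdef ((u0 + r%:R * d)%:M - \sum_(j in tau) outer (q j));
    sel_potential : potential Q ((u0 + r%:R * d)%:M - \sum_(j in tau) outer (q j))
      <= psi0 + r%:R * (L / u0)
  }.

Lemma selected0 : selected 0 finset.set0 Q0 (fun=> 0).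
Proof.
have [Qs QQ] := proj0.
split=> //; rewrite ?cards0 //; try by [move=> j; rewrite inE | move=> i j; rewrite inE].
- rewrite big_set0 subr0 mul0r addr0; split; first by rewrite tr_scalar_mx.
  by move=> x x0; rewrite mul_scalar_mx dotvZr mulr_gt0 ?dotv_gt0.
(* The barrier matrix is still [u0] times the identity, so the potential is the sum in [hpsi0]
   divided by [u0]. *)
- rewrite big_set0 subr0 !mul0r !addr0 /potential invmx_scalar.
  under eq_bigr => i _ do rewrite mul_scalar_mx dotvZr.
  by rewrite -mulr_sumr ler_pdivrMl.
Qed.

Lemma sum_outer_mul (tau : {set 'I_n}) (q : 'I_n -> 'cV[R]_k) x :
  (\sum_(j in tau) outer (q j)) *m x = \sum_(j in tau) dotv (q j) x *: q j.
Proof. by rewrite mulmx_suml; apply: eq_bigr => j _; rewrite outer_mul. Qed.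

(** The chosen column adds the direction [p = w j - Q w j] to the range of [Q]. The barrier shift
    pays for the new rank-one term, so the step costs only the [L / u'] of [potential_extend], at
    most [L / u0]. *)
Lemma selectedS r tau Q q : (r < N)%N -> selected r tau Q q ->
  exists tau' Q' q', selected r.+1 tau' Q' q'.
Proof.
move=> rN [crd disj pQ QQ0 Qq Qw Q0p pq orth pd pot].
set U := (_ - _) in pd pot; set u' := u0 + r.+1%:R * d.
have rN1 : r%:R + 1 <= N%:R :> R by rewrite natr1 ler_nat.
have Lu : 0 <= L / u0 by rewrite divr_ge0 // ltW.
have u'0 : u0 <= u' by rewrite lerDl mulr_ge0 // ltW.
have u'1 : u' < 1.
  by apply: le_lt_trans small; rewrite lerD2l ler_pM2r // ler_nat.
(* [room] budgets for [N] indices and at most [r <= N - 1] have been used, which makes the required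
   inequality strict. *)
have [|j [jT pd' pot']] := @potential_choice Q U d _ (T :|: tau) pQ pd d_gt0 pot.
  have : #|T :|: tau|%:R <= #|T|%:R + r%:R :> R.
    by rewrite -natrD ler_nat -crd cardsU leq_subr.
  have : r%:R * (L / u0) <= N%:R * (L / u0) by rewrite ler_wpM2r // ler_nat ltnW.
  move: room rN1; lra.
move: jT; rewrite inE negb_or => /andP[jT jtau].
set qj := Q *m w j in pd' pot'.
pose q' i := if i == j then qj else q i.
pose p := w j - qj.
have q'E i : i \in tau -> q' i = q i.
  by move=> itau; rewrite /q'; case: eqP => // ij; move: jtau; rewrite -ij itau.
have q'j : q' j = qj by rewrite /q' eqxx.
have UE : u'%:M - \sum_(i in j |: tau) outer (q' i) = U + d%:M - outer qj.
  rewrite big_setU1 //= q'j (eq_bigr (fun i => outer (q i))); last first.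
    by move=> i itau; rewrite q'E.
  rewrite /U /u' -natr1 mulrDl mul1r addrA raddfD /=.
  rewrite opprD addrA [LHS]addrAC; congr (_ - _).
  by rewrite addrAC.
have [Qs QQ] := pQ.
have Qqj : Q *m qj = qj by rewrite mulmxA QQ.
have Qp : Q *m p = 0 by rewrite mulmxBr Qqj subrr.
have pqj : dotv p qj = 0 by rewrite -Qqj -projector_dotv // Qp dotv0l.
(* Positivity of the new barrier matrix at [qj] itself gives [|qj|^4 < u' |qj|^2] with [u' < 1]. As
   [w j] is a unit vector, [p] is then nonzero. *)
have qj_lt1 : dotv qj qj < 1.
  have [->|qj0] := eqVneq qj 0; first by rewrite dotv0l.
  have := pd'.2 _ qj0; rewrite -UE mulmxBl mul_scalar_mx sum_outer_mul.
  rewrite big_setU1 //= q'j !dotv_lin dotv_sumr.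
  have : 0 <= \sum_(i in tau) dotv qj (dotv (q' i) qj *: q' i).
    by apply: sumr_ge0 => i _; rewrite dotvZr (dotvC qj) -expr2 sqr_ge0.
  have := dotv_gt0 qj0; nra.
have p0 : p != 0.
  apply/eqP => pE; move: qj_lt1; suff -> : qj = w j by rewrite unit_w ltxx.
  by apply/esym/eqP; rewrite -subr_eq0 -/p pE.
have Q0Q : Q0 *m Q = Q0.
  by apply: trmx_inj; rewrite trmx_mul Qs proj0.1 QQ0.
have Q0p' : Q0 *m p = 0 by rewrite -Q0Q -mulmxA Qp mulmx0.
have porth i : i \in tau -> dotv (w i - q i) p = 0.
  move=> itau; have -> : w i - q i = Q *m (w i - q i).
    by rewrite mulmxBr Qw // Qq.
  by rewrite projector_dotv // Qp dotv0r.
have pp0 : dotv p p != 0 by rewrite dotv_eq0.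
have E_fix x : Q *m x = x -> extend_proj Q p *m x = x.
  move=> Qx; rewrite extend_proj_mul Qx -[x in dotv p x]Qx -projector_dotv // Qp.
  by rewrite dotv0l mul0r scale0r addr0.
exists (j |: tau), (extend_proj Q p), q'; split.
- by rewrite cardsU1 jtau crd.
- by move=> i; rewrite inE => /orP[/set1P ->|/disj].
- exact: projector_extend.
- rewrite /extend_proj mulmxDl QQ0 -scalemxAl -mulmxA.
  suff -> : p^T *m Q0 = 0 by rewrite mulmx0 scaler0 addr0.
  by apply: trmx_inj; rewrite trmx_mul trmxK proj0.1 Q0p' trmx0.
- move=> i; rewrite inE => /orP[/set1P ->|itau]; first by rewrite q'j E_fix.
  by rewrite q'E // E_fix // Qq.
- move=> i; rewrite inE => /orP[/set1P ->|itau]; last by rewrite E_fix // Qw.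
  have wE : w j = qj + p by rewrite /p addrC subrK.
  rewrite [in LHS]wE mulmxDr E_fix // extend_proj_mul Qp add0r divff // scale1r.
  by rewrite -wE.
- move=> i; rewrite inE => /orP[/set1P ->|itau]; first by rewrite q'j.
  by rewrite q'E // Q0p.
- move=> i; rewrite inE => /orP[/set1P ->|itau]; first by rewrite q'j.
  by rewrite q'E // pq.
- move=> i i'; rewrite !inE => /orP[/eqP ->|itau] /orP[/eqP ->|i'tau] ii'.
  + by rewrite eqxx in ii'.
  + by rewrite q'j q'E // dotvC porth.
  + by rewrite q'j q'E // porth.
  + by rewrite !q'E // orth.
- by rewrite -/u' UE.
- rewrite -/u' UE.
  (* All vectors [q' i] lie in the old range of [Q], which is orthogonal to [p], so only the scalar
     part acts on [p]. *)
  have Vp : (U + d%:M - outer qj) *m p = u' *: p.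
    rewrite -UE mulmxBl mul_scalar_mx sum_outer_mul big1 ?subr0 // => i.
    rewrite in_setU1 => /orP[/eqP ->|itau].
      by rewrite q'j dotvC pqj scale0r.
    by rewrite q'E // -{1}(Qq i itau) projector_dotv // Qp dotv0r scale0r.
  apply: (@le_trans _ _ (potential Q (U + d%:M - outer qj) + L / u')).
    by apply: potential_extend => //; exact: lt_le_trans u'0.
  rewrite -natr1 mulrDl mul1r addrA lerD //; first exact: le_trans pot.
  rewrite ler_wpM2l // lef_pV2 // posrE //; exact: lt_le_trans u'0.
Qed.

Lemma selected_exists : exists tau Q q, selected N tau Q q.
Proof.
have : forall r, (r <= N)%N -> exists tau Q q, selected r tau Q q.
  elim=> [_|r IH rN]; first by exists finset.set0, Q0, (fun=> 0); exact: selected0.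
  by have [tau [Q [q sel]]] := IH (ltnW rN); exact: selectedS sel.
exact.
Qed.

End Selection.

(** * Choosing well conditioned columns *)

Section SelectionMatrices.
Variables (R : realType).

Definition sel_mx n m (s : 'I_m -> 'I_n) : 'M[R]_(n, m) :=
  \matrix_(i, k) (i == s k)%:R.

Definition comb_mx n m (s1 s2 : 'I_m -> 'I_n) (l : R) : 'M[R]_(n, m) :=
  Num.sqrt l *: sel_mx s1 + Num.sqrt (1 - l) *: sel_mx s2.

Lemma mul_mx_sum p m (B : 'M[R]_(p, m)) (a : 'cV[R]_m) :
  B *m a = \sum_k a k 0 *: col k B.
Proof.
apply/colP => i; rewrite mxE summxE; apply: eq_bigr => k _.
by rewrite !mxE mulrC.
Qed.

Lemma col_mul_sel p n m (A : 'M[R]_(p, n)) (s : 'I_m -> 'I_n) k :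
  col k (A *m sel_mx s) = col (s k) A.
Proof.
apply/colP => i; rewrite !mxE (bigD1 (s k)) //= !mxE eqxx mulr1 big1 ?addr0 //.
by move=> j /negPf jk; rewrite !mxE jk mulr0.
Qed.

Lemma mul_sel_sum p n m (A : 'M[R]_(p, n)) (s : 'I_m -> 'I_n) a :
  A *m (sel_mx s *m a) = \sum_k a k 0 *: col (s k) A.
Proof.
by rewrite mulmxA mul_mx_sum; apply: eq_bigr => k _; rewrite col_mul_sel.
Qed.

Lemma sel_mx_gram n m (s1 s2 : 'I_m -> 'I_n) k l :
  ((sel_mx s1)^T *m sel_mx s2) k l = (s1 k == s2 l)%:R.
Proof.
rewrite mxE (bigD1 (s1 k)) //= !mxE eqxx mul1r big1 ?addr0 // => i /negPf ik.
by rewrite !mxE ik mul0r.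
Qed.

Lemma homo_lt_inj n m (s : 'I_m -> 'I_n) :
  {homo s : k l / (k < l)%N} -> injective s.
Proof.
move=> hs k l skl; apply/val_inj; case: (ltngtP k l) => // /hs;
  by rewrite skl ltnn.
Qed.

Lemma comb_mx_orth n m (s1 s2 : 'I_m -> 'I_n) (l : R) :
  injective s1 -> injective s2 -> (forall i j, s1 i != s2 j) -> 0 <= l <= 1 ->
  (comb_mx s1 s2 l)^T *m comb_mx s1 s2 l = 1%:M.
Proof.
move=> i1 i2 dj /andP[l0 l1]; apply/matrixP => i j.
rewrite /comb_mx [(_ + _)^T]linearD /= [(_ *: sel_mx s1)^T]linearZ [(_ *: sel_mx s2)^T]linearZ /= mulmxDl !mulmxDr -!scalemxAl -!scalemxAr !scalerA.
rewrite [LHS]mxE [X in X + _]mxE [X in _ + X]mxE.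
have ZE c (M : 'M[R]_m) : (c *: M) i j = c * M i j by rewrite mxE.
rewrite !ZE !sel_mx_gram (negPf (dj _ _)) [s2 i == _]eq_sym (negPf (dj _ _)).
rewrite (inj_eq i1) (inj_eq i2) !mulr0 addr0 add0r -mulrDl -!expr2.
by rewrite !sqr_sqrtr ?subr_ge0 // addrC subrK mul1r mxE.
Qed.

(** Passes from the unordered selected set to the increasing enumeration that [comb_mx] is fed with;
    the last clause transports sums. *)
Lemma enum_set_increasing n (tau : {set 'I_n}) m : #|tau| = m ->
  exists s : 'I_m -> 'I_n, [/\ {homo s : k l / (k < l)%N},
    (forall k, s k \in tau) &
    forall F : 'I_n -> R, \sum_k F (s k) = \sum_(j in tau) F j].
Proof.
move=> <-; exists (fun k => Order.enum_val k); split=> [k l kl|k|F].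
- suff : (Order.enum_val k < Order.enum_val l)%O by [].
  have mono i j := @Order.le_enum_val _ 'I_n (@Order.le_total _ _) (mem tau) i j.
  by rewrite (leW_mono mono).
- exact: Order.enum_valP.
- have tauE : tau = [set Order.enum_val k | k in [set: 'I_#|tau|]].
    apply/esym/eqP; rewrite eqEcard card_imset; last exact: Order.enum_val_inj.
    rewrite cardsT card_ord leqnn andbT; apply/fintype.subsetP => j /imsetP[k _ ->].
    exact: Order.enum_valP.
  rewrite [in RHS]tauE big_imset /=; last by move=> k l _ _; exact: Order.enum_val_inj.
  by apply: eq_bigl => k; rewrite inE.
Qed.

Lemma sum_dotv_tr p n (B : 'M[R]_(p, n)) :
  \sum_i dotv (col i B) (col i B) = \tr (B^T *m B).
Proof.
apply: eq_bigr => i _; rewrite mxE; apply: eq_bigr => j _.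
by rewrite !mxE.
Qed.

End SelectionMatrices.

(** * Passing from one well conditioned set of columns to a disjoint one *)

Section Switch.
Variables (R : realType) (n : nat) (A : 'M[R]_n) (L : R).
Hypothesis A_le : forall x, dotv (A *m x) (A *m x) <= L * dotv x x.
Hypothesis A_unit : forall i, dotv (col i A) (col i A) = 1.

(** A matrix and its transpose have the same norm: for [y = A^T x], [|y|^2 = <x, A y>], and
    Cauchy-Schwarz leaves one factor [|y|^2] to cancel. *)
Lemma trmx_bound x : dotv (A^T *m x) (A^T *m x) <= L * dotv x x.
Proof.
set y := A^T *m x; have [->|y0] := eqVneq y 0.
  rewrite dotv0l; have [->|x0] := eqVneq x 0; first by rewrite dotv0l mulr0.
  by apply: le_trans (A_le x); rewrite dotv_ge0.
have yE : dotv y y = dotv x (A *m y) by rewrite {1}/y dotv_mull trmxK.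
have yp := dotv_gt0 y0.
rewrite -(ler_pM2l yp) -expr2 {1}yE; apply: le_trans (dotv_cauchy _ _) _.
apply: le_trans (ler_wpM2l (dotv_ge0 x) (A_le y)) _.
by rewrite le_eqVlt; apply/orP; left; apply/eqP; ring.
Qed.

Lemma bessel_col x : \sum_i dotv (col i A) x ^+ 2 <= L * dotv x x.
Proof.
apply: le_trans (trmx_bound x); rewrite le_eqVlt; apply/orP; left; apply/eqP.
apply: eq_bigr => i _; rewrite expr2 mxE; congr (_ * _);
  by apply: eq_bigr => j _; rewrite !mxE.
Qed.

Lemma bound_ge1 : (0 < n)%N -> 1 <= L.
Proof.
move=> n0; pose i := Ordinal n0.
have := A_le (basis_vec R i); rewrite -colE A_unit.
suff -> : dotv (basis_vec R i) (basis_vec R i) = 1 by rewrite mulr1.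
rewrite /dotv (bigD1 i) //= !mxE !eqxx mulr1 big1 ?addr0 // => j /negPf ji.
by rewrite !mxE ji mul0r.
Qed.

(** [Q = B (B^T B)^-1 B^T] has trace [m]. The sum is the squared Hilbert-Schmidt norm of [Q A],
    hence of [A^T Q], and so is at most [L] times that of [Q], which is [m]. *)
Lemma range_projector m (B : 'M[R]_(n, m)) (c : R) : 0 < c ->
  (forall a, c * dotv a a <= dotv (B *m a) (B *m a)) ->
  exists2 Q : 'M[R]_n, projector Q & Q *m B = B /\
    \sum_i dotv (Q *m col i A) (Q *m col i A) <= L * m%:R.
Proof.
move=> c0 Bge; pose G := B^T *m B.
have Gs : G^T = G by rewrite trmx_mul trmxK.
have pG : posdef G.
  split=> // a a0; rewrite -mulmxA -dotv_mull.
  by apply: lt_le_trans (Bge a); rewrite mulr_gt0 ?dotv_gt0.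
have uG := posdef_unit pG.
pose Q := B *m invmx G *m B^T.
have Qs : Q^T = Q by rewrite !trmx_mul trmxK trmx_inv Gs mulmxA.
have QB : Q *m B = B by rewrite /Q -mulmxA -/G -mulmxA mulVmx // mulmx1.
have QQ : Q *m Q = Q by rewrite {2}/Q -mulmxA !mulmxA QB.
have trQ : \tr Q = m%:R.
  by rewrite /Q -mulmxA mxtrace_mulC -mulmxA -/G mulVmx // mxtrace1.
clearbody Q; exists Q => //; split=> //.
have colM (C D : 'M[R]_n) i : C *m col i D = col i (C *m D).
  by rewrite !colE mulmxA.
under eq_bigr => i _ do rewrite colM.
rewrite sum_dotv_tr mxtrace_mulC.
have -> : Q *m A *m (Q *m A)^T = (A^T *m Q)^T *m (A^T *m Q).
  by rewrite !trmx_mul trmxK Qs.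
have -> : m%:R = \tr (Q^T *m Q) by rewrite Qs QQ.
rewrite -!sum_dotv_tr mulr_sumr.
by apply: ler_sum => i _; rewrite -colM trmx_bound.
Qed.

(** The dual of the Bessel inequality: the synthesis map obeys the same bound as its adjoint, the
    analysis map. *)
Lemma norm_sum_bessel (I : finType) (q : I -> 'cV[R]_n) (u : R) (a : I -> R) :
  0 <= u -> (forall x, \sum_i dotv (q i) x ^+ 2 <= u * dotv x x) ->
  dotv (\sum_i a i *: q i) (\sum_i a i *: q i) <= u * \sum_i a i ^+ 2.
Proof.
move=> u0 hq; set x := \sum_i _; have [->|x0] := eqVneq x 0.
  by rewrite dotv0l mulr_ge0 // sumr_ge0 // => i _; exact: sqr_ge0.
have xp := dotv_gt0 x0.
have xE : dotv x x = \sum_i a i * dotv (q i) x.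
  by rewrite {1}/x dotv_suml; apply: eq_bigr => i _; rewrite dotvZl.
set S := \sum_i _ ^+ 2 in hq *; set D := dotv x x in xE xp *.
have S0 : 0 <= S by apply: sumr_ge0 => i _; exact: sqr_ge0.
(* Since the [a i * dotv (q i) x] sum to [D], expanding these squares gives Cauchy-Schwarz
   multiplied by [S]. *)
have : 0 <= \sum_i (S * dotv (q i) x - D * a i) ^+ 2.
  by apply: sumr_ge0 => i _; exact: sqr_ge0.
have -> : \sum_i (S * dotv (q i) x - D * a i) ^+ 2 =
    S ^+ 2 * (\sum_i dotv (q i) x ^+ 2) - S * D ^+ 2.
  rewrite (eq_bigr (fun i => S ^+ 2 * dotv (q i) x ^+ 2
     - 2 * S * D * (a i * dotv (q i) x) + D ^+ 2 * a i ^+ 2)); last first.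
    by move=> i _; ring.
  rewrite big_split /= sumrB -!mulr_sumr -xE -/S; ring.
move=> h; have := hq x; rewrite -/D => h2.
have [S_eq0|Sn0] := eqVneq S 0.
  suff : D = 0 by move=> D0; rewrite D0 ltxx in xp.
  rewrite xE big1 // => i _.
  have : a i ^+ 2 <= S by rewrite /S (bigD1 i) //= lerDl sumr_ge0 // => j _; exact: sqr_ge0.
  rewrite S_eq0 => hai; have : a i ^+ 2 == 0 by rewrite eq_le hai sqr_ge0.
  by rewrite sqrf_eq0 => /eqP ->; rewrite mul0r.
have Sp : 0 < S by rewrite lt_def Sn0.
have : S * (S * (u * D) - D ^+ 2) >= 0.
  by have := ler_wpM2l (sqr_ge0 S) h2; move: h; lra.
rewrite pmulr_rge0 // subr_ge0 expr2 mulrA ler_pM2r // mulrC //.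
Qed.

(** A combination of the selected columns is [P + z]: [P] combines the mutually orthogonal parts, of
    squared norm at least 15/16, and [z] the parts controlled by the barrier. The splitting stays in
    the conclusion because the switch needs [P] orthogonal to the range of [Q0]. *)
Lemma well_conditioned_selection m (T : {set 'I_n}) (Q0 : 'M[R]_n) : (0 < n)%N ->
  512 * (m%:R * L) <= n%:R -> (#|T| <= m)%N -> projector Q0 ->
  \sum_i dotv (Q0 *m col i A) (Q0 *m col i A) <= L * m%:R ->
  exists s : 'I_m -> 'I_n, [/\ {homo s : k l / (k < l)%N},
    (forall k, s k \notin T),
    (forall a, 1 / 2 * dotv a a <= dotv (A *m (sel_mx R s *m a)) (A *m (sel_mx R s *m a))) &
    forall a, exists P z, [/\ A *m (sel_mx R s *m a) = P + z,
      Q0 *m P = 0 & dotv z z <= 1 / 16 * dotv a a]].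
Proof.
move=> n0 hm leT pQ0 trQ0; have L1 := bound_ge1 n0; have L0 : 0 <= L by lra.
have nR : 0 < n%:R :> R by rewrite ltr0n.
have cT : #|T|%:R <= m%:R :> R by rewrite ler_nat.
(* The barrier starts at [1 / 32] and moves [m] times by [d], so it ends below
   [1 / 16], while [L / d = n / 4] leaves room in the averaging. *)
pose d := 4 * L / n%:R.
have d0 : 0 < d by rewrite divr_gt0 // mulr_gt0 //; lra.
have mL : m%:R <= m%:R * L by rewrite ler_peMr.
have md : m%:R * d <= 1 / 32.
  rewrite /d mulrA ler_pdivrMr //; lra.
have Ld : L / d = n%:R / 4 by rewrite /d; field; rewrite !gt_eqF //; lra.
(* The initial potential [32 m L] is [L m] divided by the barrier 1/32, and the [m] extensions cost
   another [32 m L]; [m L <= n / 512] makes both fit. *)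
have [||||tau [Q [q sel]]] := @selected_exists R n n (fun i => col i A) L L0
  bessel_col A_unit T Q0 (1 / 32) d (32 * (m%:R * L)) m pQ0 _ d0.
- by lra.
- by apply: le_trans trQ0 _; lra.
- rewrite Ld; lra.
- lra.
have [s2 [s2h s2tau s2sum]] := enum_set_increasing R (sel_card sel).
have s2i := homo_lt_inj s2h.
(* Nonnegativity of the final barrier form is a Bessel inequality for the [q j], with constant
   [1 / 32 + m d <= 1 / 16]. *)
have q_bound x : \sum_(k < m) dotv (q (s2 k)) x ^+ 2 <= 1 / 16 * dotv x x.
  rewrite (s2sum (fun j => dotv (q j) x ^+ 2)).
  have := posdef_ge0 x (sel_posdef sel).
  rewrite mulmxBl mul_scalar_mx sum_outer_mul !dotv_lin dotv_sumr subr_ge0 => h.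
  have -> : \sum_(j in tau) dotv (q j) x ^+ 2 = \sum_(j in tau) dotv x (dotv (q j) x *: q j).
    by apply: eq_bigr => j _; rewrite dotvZr (dotvC x) expr2.
  apply: le_trans h _; rewrite ler_wpM2r ?dotv_ge0 //; lra.
pose p j := col j A - q j.
pose Pa (a : 'cV[R]_m) := \sum_(k < m) a k 0 *: p (s2 k).
pose qa (a : 'cV[R]_m) := \sum_(k < m) a k 0 *: q (s2 k).
have yE a : A *m (sel_mx R s2 *m a) = Pa a + qa a.
  rewrite mul_sel_sum -big_split; apply: eq_bigr => k _ /=.
  by rewrite -scalerDr subrK.
have aE (a : 'cV[R]_m) : dotv a a = \sum_k a k 0 ^+ 2 by [].
have qa_le a : dotv (qa a) (qa a) <= 1 / 16 * dotv a a.
  by apply: norm_sum_bessel; [lra | exact: q_bound].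
have pp k : 15 / 16 <= dotv (p (s2 k)) (p (s2 k)).
  have qq : dotv (q (s2 k)) (q (s2 k)) <= 1 / 16.
    have [->|q0] := eqVneq (q (s2 k)) 0; first by rewrite dotv0l; lra.
    have := q_bound (q (s2 k)); rewrite (bigD1 k) //= => h.
    have := dotv_gt0 q0.
    have : 0 <= \sum_(i < m | i != k) dotv (q (s2 i)) (q (s2 k)) ^+ 2.
      by apply: sumr_ge0 => i _; exact: sqr_ge0.
    move: h; nra.
  have := A_unit (s2 k); have := sel_pq sel (s2tau k); rewrite -/(p (s2 k)).
  have -> : col (s2 k) A = p (s2 k) + q (s2 k) by rewrite subrK.
  move: (p _) (q _) qq => P' q' qq.
  rewrite !dotv_lin (dotvC q' P') => ->; lra.
have Pa_ge a : 15 / 16 * dotv a a <= dotv (Pa a) (Pa a).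
  rewrite aE mulr_sumr dotv_suml; apply: ler_sum => k _.
  rewrite dotvZl dotv_sumr (bigD1 k) //= big1 ?addr0; last first.
    move=> l lk; rewrite dotvZr (sel_orth sel) ?mulr0 //.
    by rewrite (inj_eq s2i) eq_sym.
  rewrite dotvZr mulrA -expr2 mulrC ler_wpM2l ?sqr_ge0 //; exact: pp.
have ya_ge a : 1 / 2 * dotv a a <= dotv (A *m (sel_mx R s2 *m a)) (A *m (sel_mx R s2 *m a)).
  (* The square below yields [|P + z|^2 >= 3/4 |P|^2 - 3 |z|^2], at least [33/64 |a|^2]. *)
  rewrite yE !dotv_lin (dotvC (qa a) (Pa a)).
  have := dotv_ge0 (1 / 2 *: Pa a + 2 *: qa a).
  rewrite !dotv_lin (dotvC (qa a) (Pa a)).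
  have := qa_le a; have := Pa_ge a; have := dotv_ge0 a; lra.
exists s2; split=> // [k|a]; first exact: (sel_disj sel).
exists (Pa a), (qa a); split=> //.
rewrite mulmx_sumr big1 // => k _.
by rewrite -scalemxAr (sel_p0 sel) // scaler0.
Qed.

(** The selection with no excluded index and the zero projection. *)
Lemma well_conditioned_start m : (0 < n)%N -> 512 * (m%:R * L) <= n%:R ->
  exists s : 'I_m -> 'I_n, {homo s : k l / (k < l)%N} /\
    forall a, 1 / 2 * dotv a a <= dotv (A *m (sel_mx R s *m a)) (A *m (sel_mx R s *m a)).
Proof.
move=> n0 hm; have L1 := bound_ge1 n0.
have [|||s [sh _ sge _]] := @well_conditioned_selection m finset.set0 0 n0 hm.
- by rewrite cards0.
- by split; rewrite ?trmx0 ?mul0mx.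
- rewrite big1; first by rewrite mulr_ge0 //; lra.
  by move=> i _; rewrite mul0mx dotv0l.
by exists s.
Qed.

(** Take [Q0] onto the range of [A] on [s1] and exclude the indices of [s1]. In the mixed
    combination, [x] then meets only the small part [z] of the new columns. *)
Lemma well_conditioned_switch m (s1 : 'I_m -> 'I_n) : (0 < n)%N ->
  512 * (m%:R * L) <= n%:R ->
  (forall a, 1 / 4 * dotv a a <= dotv (A *m (sel_mx R s1 *m a)) (A *m (sel_mx R s1 *m a))) ->
  exists s2 : 'I_m -> 'I_n, [/\ {homo s2 : k l / (k < l)%N},
    (forall k l, s1 k != s2 l),
    (forall a, 1 / 2 * dotv a a <= dotv (A *m (sel_mx R s2 *m a)) (A *m (sel_mx R s2 *m a))) &
    forall l a, 0 <= l <= 1 ->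
      4 / 25 * dotv a a <= dotv (A *m (comb_mx s1 s2 l *m a)) (A *m (comb_mx s1 s2 l *m a))].
Proof.
move=> n0 hm good; pose B := A *m sel_mx R s1.
have [||Q0 pQ0 [Q0B trQ0]] := @range_projector m B (1 / 4) _ _; first by lra.
  by move=> a; rewrite -mulmxA.
pose T := [set s1 k | k : 'I_m].
have cT : (#|T| <= m)%N by rewrite (leq_trans (leq_imset_card _ _)) // card_ord.
have [s2 [s2h s2T ya_ge dec]] := well_conditioned_selection n0 hm cT pQ0 trQ0.
exists s2; split=> //.
  move=> k l; apply/eqP => kl; have := s2T l.
  by rewrite -kl imset_f.
move=> l a /andP[l0 l1].
have -> : A *m (comb_mx s1 s2 l *m a) = Num.sqrt l *: (A *m (sel_mx R s1 *m a))
    + Num.sqrt (1 - l) *: (A *m (sel_mx R s2 *m a)).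
  by rewrite /comb_mx mulmxDl mulmxDr -!scalemxAl -!scalemxAr.
have sl : Num.sqrt l * Num.sqrt l = l by rewrite -expr2 sqr_sqrtr.
have sm : Num.sqrt (1 - l) * Num.sqrt (1 - l) = 1 - l.
  by rewrite -expr2 sqr_sqrtr // subr_ge0.
move: sl sm; set sl := Num.sqrt l; set sm := Num.sqrt (1 - l) => slE smE.
have := good a; have := ya_ge a; have [P [z [-> Q0P hz]]] := dec a; move: hz.
set x := A *m (sel_mx R s1 *m a).
have xP : dotv x P = 0.
  have -> : x = Q0 *m (B *m a) by rewrite [RHS]mulmxA Q0B /B -mulmxA.
  by rewrite projector_dotv // Q0P dotv0r.
(* This square absorbs the only cross term, [<x, z>]. With [Y = PP + 2 Pz + Z], at least
   [3/4 l X + (1 - l) (Y - 4 Z)] remains, hence at least [3/16 N], and 3/16 exceeds 4/25. *)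
have := dotv_ge0 (1 / 2 *: (sl *: x) + 2 *: (sm *: z)).
rewrite !dotv_lin (dotvC z x) (dotvC z P) (dotvC P x) xP.
move: (dotv x x) (dotv z z) (dotv P P) (dotv P z) (dotv x z) (dotv_ge0 a).
set N := dotv a a => X Z PP Pz xz N0 h hZ hY hX.
have h' : 0 <= 1 / 4 * l * X + 2 * (sl * sm * xz) + 4 * (1 - l) * Z.
  have -> : 1 / 4 * l = 1 / 4 * (sl * sl) by rewrite slE.
  by move: h; rewrite -smE; congr (_ <= _); field.
apply: (@le_trans _ _ (l * X + (1 - l) * (PP + 2 * Pz + Z) + 2 * (sl * sm * xz))); last first.
  rewrite le_eqVlt; apply/orP; left; apply/eqP.
  have -> : l * X = sl * sl * X by rewrite slE.
  by rewrite -smE; ring.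
have m0 : 0 <= 1 - l by rewrite subr_ge0.
have hY' : 1 / 2 * N <= PP + 2 * Pz + Z by move: hY; lra.
have := ler_wpM2l l0 hX; have := ler_wpM2l m0 hY'; have := ler_wpM2l m0 hZ.
have := mulr_ge0 l0 N0; have := mulr_ge0 m0 N0.
lra.
Qed.

End Switch.

(** * Continuous paths of subspaces *)

Section MatrixPaths.
Local Open Scope classical_set_scope.
Variables (R : realType) (p q : nat).
Implicit Types V W : R -> 'M[R]_(p, q).

Definition mx_path_continuous V := forall i j, continuous (fun t => V t i j).

Lemma mx_path_continuousD V W : mx_path_continuous V -> mx_path_continuous W ->
  mx_path_continuous (fun t => V t + W t).
Proof.
move=> cV cW i j t.
rewrite (_ : (fun _ => _) = (fun t => V t i j + W t i j)); last first.
  by apply/funext => u; rewrite mxE.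
by apply: cvgD; [exact: cV | exact: cW].
Qed.

Lemma mx_path_continuous_cst (M : 'M[R]_(p, q)) : mx_path_continuous (fun=> M).
Proof. by move=> i j t; exact: cvg_cst. Qed.

Lemma mx_path_continuousZ (f : R -> R) (M : 'M[R]_(p, q)) : continuous f ->
  mx_path_continuous (fun t => f t *: M).
Proof.
move=> cf i j t.
rewrite (_ : (fun _ => _) = (fun t => f t * M i j)); last first.
  by apply/funext => u; rewrite mxE.
by apply: cvgM; [exact: cf | exact: cvg_cst].
Qed.

Lemma mx_path_continuous_comp V (f : R -> R) : continuous f ->
  mx_path_continuous V -> mx_path_continuous (V \o f).
Proof.
move=> cf cV i j t; apply: (@continuous_comp _ _ _ f (fun t => V t i j)).
  exact: cf.
exact: cV.
Qed.

Lemma mx_path_continuous_locally V :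
  (forall t : R, exists2 W, mx_path_continuous W & \forall u \near t, V u = W u) ->
  mx_path_continuous V.
Proof.
move=> h i j t; have [W cW VW] := h t.
have VE : V t i j = W t i j by rewrite (nbhs_singleton VW).
suff : (fun t => V t i j) @ t --> W t i j by rewrite -VE.
apply: cvg_trans (cW i j t); apply: near_eq_cvg.
by near=> u; rewrite (near VW u).
Unshelve. all: by end_near. Qed.

End MatrixPaths.

Section Close.
Local Open Scope classical_set_scope.
Variables (R : realType) (n : nat) (A : R -> 'M[R]_n).
Hypothesis cA : mx_continuous A.

Lemma mulmx_frobenius (B : 'M[R]_n) x :
  dotv (B *m x) (B *m x) <= (\sum_i \sum_j B i j ^+ 2) * dotv x x.
Proof.
rewrite mulr_suml; apply: ler_sum => i _; rewrite -expr2.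
have -> : (B *m x) i 0 = dotv (row i B)^T x.
  by rewrite mxE; apply: eq_bigr => j _; rewrite !mxE.
apply: le_trans (dotv_cauchy _ _) _; rewrite le_eqVlt; apply/orP; left.
by apply/eqP; congr (_ * _); apply: eq_bigr => j _; rewrite !mxE expr2.
Qed.

(** The squared Frobenius distance [F] is continuous, vanishes at [c] and dominates the squared
    operator norm of the difference. *)
Lemma mx_continuous_close c (e : R) : 0 < e ->
  exists2 r, 0 < r & forall t, `|t - c| < r -> forall x,
    enorm ((A t - A c) *m x) <= e * enorm x.
Proof.
move=> e0; pose F t := \sum_i \sum_j (A t i j - A c i j) ^+ 2.
have cF : continuous_at c F.
  apply: cvg_big => [|i _]; first exact: add_continuous.
  apply: cvg_big => [|j _]; first exact: add_continuous.
  have h : (fun t => A t i j - A c i j) @ c --> (A c i j - A c i j : R).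
    by apply: cvgB; [exact: cA | exact: cvg_cst].
  by under eq_fun do rewrite expr2; rewrite expr2; exact: cvgM.
have F0 : F c = 0.
  by rewrite /F big1 // => i _; rewrite big1 // => j _; rewrite subrr expr0n.
have /cvgrPdist_lt /(_ _ (exprn_gt0 2 e0)) := cF.
rewrite F0 => /nbhs_ballP[r /= r0 hr]; exists r => // t tr x.
rewrite enorm_le; last exact: ltW.
apply: le_trans (mulmx_frobenius _ _) _; rewrite ler_wpM2r ?dotv_ge0 //.
have : `|0 - F t| < e ^+ 2 by apply: hr; rewrite /ball /= distrC.
rewrite sub0r normrN => h; apply: le_trans (ltW h).
apply: le_trans (ler_norm _); rewrite le_eqVlt; apply/orP; left; apply/eqP.
by apply: eq_bigr => i _; apply: eq_bigr => j _; rewrite !mxE.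
Qed.

End Close.

(** * Linking well conditioned selections over a compact interval *)

Section Paths.
Local Open Scope classical_set_scope.
Variables (R : realType) (n m : nat).
Implicit Types (A : R -> 'M[R]_n) (V : R -> 'M[R]_(n, m)) (s : 'I_m -> 'I_n).

(** The bound is against the coefficients [a]; for orthonormal columns these have the norm of
    [W *m a]. *)
Definition bounded_below (c : R) (B : 'M[R]_n) (W : 'M[R]_(n, m)) :=
  forall a : 'cV_m, c * enorm a <= enorm (B *m (W *m a)).

Definition is_comb (W : 'M[R]_(n, m)) := exists s1 s2 l,
  [/\ {homo s1 : k k' / (k < k')%N}, {homo s2 : k k' / (k < k')%N},
      (forall k k', s1 k != s2 k'), 0 <= l <= 1 & W = comb_mx s1 s2 l].

Lemma isometry_enorm (W : 'M[R]_(n, m)) a : W^T *m W = 1%:M ->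
  enorm (W *m a) = enorm a.
Proof. by move=> WW; rewrite /enorm dotv_mull mulmxA WW mul1mx. Qed.

Lemma bounded_below_perturb (c e : R) (B C : 'M[R]_n) (W : 'M[R]_(n, m)) :
  W^T *m W = 1%:M -> (forall x, enorm ((C - B) *m x) <= e * enorm x) ->
  bounded_below c B W -> bounded_below (c - e) C W.
Proof.
move=> WW close h a; have := h a; have := close (W *m a).
rewrite isometry_enorm // mulmxBl => h1 h2.
have := enormD (C *m (W *m a)) (- (C *m (W *m a) - B *m (W *m a))).
by rewrite enormN opprB addrC subrK; lra.
Qed.

Lemma sel_mx_isometry s : {homo s : k k' / (k < k')%N} ->
  (sel_mx R s)^T *m sel_mx R s = 1%:M.
Proof.
move=> /homo_lt_inj si; apply/matrixP => i j.
by rewrite sel_mx_gram (inj_eq si) mxE.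
Qed.

Lemma comb_mx1 s1 s2 : comb_mx s1 s2 1 = sel_mx R s1.
Proof. by rewrite /comb_mx subrr sqrtr0 sqrtr1 scale1r scale0r addr0. Qed.

Lemma comb_mx0 s1 s2 : comb_mx s1 s2 0 = sel_mx R s2.
Proof. by rewrite /comb_mx subr0 sqrtr0 sqrtr1 scale1r scale0r add0r. Qed.

(** Endpoints satisfy the bound 1/2, stronger than the 1/4 along a path, so that constants do not
    deteriorate from link to link. *)
Definition good_start A t s :=
  {homo s : k k' / (k < k')%N} /\ bounded_below (1 / 2) (A t) (sel_mx R s).

(** Paths live on the whole line and rest outside [[a, b]], so that two of them are glued by adding
    them and subtracting the common selection. *)
Definition good_path A (a b : R) s V s' :=
  [/\ mx_path_continuous V,
      (forall t, t <= a -> V t = sel_mx R s) /\ (forall t, b <= t -> V t = sel_mx R s'),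
      (forall t, a <= t <= b -> is_comb (V t) /\ bounded_below (1 / 4) (A t) (V t)) &
      good_start A b s'].

Definition linkable A (a b : R) :=
  forall s, good_start A a s -> exists V s', good_path A a b s V s'.

Lemma linkable_trans A a b c : a <= b -> b <= c ->
  linkable A a b -> linkable A b c -> linkable A a c.
Proof.
move=> ab bc hab hbc s gs.
have [V [s1 [cV [Va Vb] gV gs1]]] := hab s gs.
have [W [s2 [cW [Wb Wc] gW gs2]]] := hbc s1 gs1.
(* At each time one of the two paths rests at [sel_mx R s1]. *)
exists (fun t => V t + W t - sel_mx R s1), s2; split=> //.
- apply: mx_path_continuousD; last exact: mx_path_continuous_cst.
  exact: mx_path_continuousD.
- split=> t h.
    by rewrite Va // Wb ?(le_trans h) // addrK.
  by rewrite Wc // Vb ?(le_trans bc) // addrAC subrr add0r.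
- move=> t /andP[h1 h2]; have [tb|bt] := leP t b.
    by rewrite Wb // addrK; apply: gV; rewrite h1.
  by rewrite Vb ?ltW // addrAC subrr add0r; apply: gW; rewrite h2 ltW.
Qed.

Definition ramp (a b t : R) := Num.max 0 (Num.min 1 ((b - t) / (b - a))).

Lemma ramp_continuous a b : continuous (ramp a b).
Proof.
(* The minimum is written as a negated maximum, so that continuity of maxima suffices. *)
have -> : ramp a b = (fun=> 0) \max (- ((fun=> -1) \max (fun t => (t - b) / (b - a)))).
  apply/funext => t; rewrite /ramp /=; congr (Num.max _ _).
  rewrite fctE oppr_max opprK; congr (Num.min _ _).
  by rewrite -mulNr opprB.
move=> t; apply: continuous_max; first exact: cvg_cst.
apply: cvgN; apply: continuous_max; first exact: cvg_cst.
apply: cvgM; last exact: cvg_cst.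
by apply: cvgB; [exact: cvg_id | exact: cvg_cst].
Qed.

Lemma ramp01 a b t : 0 <= ramp a b t <= 1.
Proof. by rewrite /ramp le_max lexx /= ge_max ler01 ge_min lexx. Qed.

Lemma ramp_left a b t : a < b -> t <= a -> ramp a b t = 1.
Proof.
move=> ab ta; rewrite /ramp min_l ?max_r ?ler01 //.
by rewrite ler_pdivlMr ?subr_gt0 // mul1r lerD2l lerN2.
Qed.

Lemma ramp_right a b t : a < b -> b <= t -> ramp a b t = 0.
Proof.
move=> ab bt; rewrite /ramp max_l // ge_min; apply/orP; right.
by rewrite ler_pdivrMr ?subr_gt0 // mul0r subr_le0.
Qed.

Lemma comb_path_continuous s1 s2 (f : R -> R) : continuous f ->
  mx_path_continuous (fun t => comb_mx s1 s2 (f t)).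
Proof.
move=> cf; apply: mx_path_continuousD; apply: mx_path_continuousZ => t.
  by apply: (@continuous_comp _ _ _ f); [exact: cf | exact: sqrt_continuous].
apply: (@continuous_comp _ _ _ (fun t => 1 - f t)); last exact: sqrt_continuous.
by apply: cvgB; [exact: cvg_cst | exact: cf].
Qed.

Section Fixed.
Variables (A : R -> 'M[R]_n) (L : R).
Hypothesis n_gt0 : (0 < n)%N.
Hypothesis m_small : 512 * (m%:R * L) <= n%:R.
Hypothesis cA : mx_continuous A.
Hypothesis A_le : forall t x, dotv (A t *m x) (A t *m x) <= L * dotv x x.
Hypothesis A_unit : forall t i, dotv (col i (A t)) (col i (A t)) = 1.

Lemma bounded_below_sqr (c d : R) (t : R) (W : 'M[R]_(n, m)) : 0 <= c -> c ^+ 2 <= d ->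
  (forall a, d * dotv a a <= dotv (A t *m (W *m a)) (A t *m (W *m a))) ->
  bounded_below c (A t) W.
Proof.
move=> c0 cd h a; rewrite enorm_ge //; apply: le_trans (h a).
by rewrite ler_wpM2r ?dotv_ge0.
Qed.

Lemma good_start_exists t : exists s, good_start A t s.
Proof.
have [s [sh sge]] := well_conditioned_start (A_le t) (A_unit t) n_gt0 m_small.
by exists s; split=> //; apply: bounded_below_sqr sge; lra.
Qed.

Lemma linkable_local a b : a < b ->
  (forall t, a <= t <= b -> forall x, enorm ((A t - A a) *m x) <= 1 / 10 * enorm x) ->
  linkable A a b.
Proof.
move=> ab close s [sh sge].
have [|s2 [s2h dj s2ge cge]] := well_conditioned_switch (A_le a) (A_unit a) (s1 := s) n_gt0 m_small.
  move=> v; have := sge v; rewrite enorm_ge; last by lra.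
  by rewrite expr2; lra.
have i1 := homo_lt_inj sh; have i2 := homo_lt_inj s2h.
exists (fun t => comb_mx s s2 (ramp a b t)), s2; split.
- exact/comb_path_continuous/ramp_continuous.
- split=> t ht; first by rewrite ramp_left ?comb_mx1.
  by rewrite ramp_right ?comb_mx0.
- move=> t hab; split.
    by exists s, s2, (ramp a b t); split=> //; exact: ramp01.
  (* The switch provides 4/25, which is at least the square of 7/20. *)
  have -> : 1 / 4 = 7 / 20 - 1 / 10 :> R by field.
  apply: bounded_below_perturb (close t hab) _.
    exact: comb_mx_orth (ramp01 _ _ _).
  apply: (@bounded_below_sqr _ (4 / 25)) => [||v]; [lra | rewrite expr2; lra |].
  exact: cge (ramp01 _ _ _).
(* The square of 6/10 is below the 1/2 that the switch provides for [s2] alone; this slack restores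
   the bound 1/2 at [b]. *)
- split=> //; have -> : 1 / 2 = 6 / 10 - 1 / 10 :> R by field.
  apply: (bounded_below_perturb _ (close b _)); first exact: sel_mx_isometry.
    by rewrite lexx ltW.
  by apply: bounded_below_sqr s2ge; rewrite ?expr2; lra.
Qed.

(** Continuity at the supremum [c] of the reachable points allows a link from just before [c] to
    just after it, or to [b]; hence [b] is reachable. *)
Lemma linkable_all a b : a < b -> linkable A a b.
Proof.
move=> ab; pose S : set R := [set x | a <= x <= b /\ (x = a \/ linkable A a x)].
have Sa : S a by split; [rewrite lexx ltW | left].
have Sub : ubound S b by move=> x [/andP[]].
have hS : has_sup S by split; [exists a | exists b].
pose c := sup S.
(* Two times of the short link are compared through [c], so 1/20 twice gives the 1/10 of
   [linkable_local]. *)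
have [r r0 hr] := mx_continuous_close cA c (ltac:(lra) : 0 < 1 / 20 :> R).
have r2 : 0 < r / 2 by rewrite divr_gt0.
have [x [/andP[ax xb] hx] cx] := sup_adherent r2 hS.
have xc : x <= c by apply: ub_le_sup; [exists b | split=> //; rewrite ax].
pose y := Num.min b (c + r / 2).
have yb : y <= b by rewrite ge_min lexx.
(* As [x <= c < c + r / 2], the case [y <= x] forces [x = b]. *)
have [xy|yx] := ltP x y; last first.
  have xE : x = b.
    move: yx; rewrite ge_min => /orP[bx|]; first by apply/le_anti; rewrite xb.
    by move=> h; have := le_trans h xc; lra.
  by case: hx => [xa|]; [move: ab; rewrite -xE xa ltxx | rewrite xE].
have yr : y <= c + r / 2 by rewrite ge_min lexx orbT.
have lxy : linkable A x y.
  apply: linkable_local => // t /andP[xt ty] v.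
  have ht : enorm ((A t - A c) *m v) <= 1 / 20 * enorm v.
    by apply: hr; rewrite ltr_distl; move: cx; rewrite -/c; lra.
  have hx' : enorm ((A x - A c) *m v) <= 1 / 20 * enorm v.
    by apply: hr; rewrite ltr_distl; move: cx; rewrite -/c; lra.
  have -> : A t - A x = (A t - A c) - (A x - A c).
    by rewrite opprB addrA subrK.
  rewrite mulmxBl; apply: le_trans (enormD _ _) _; rewrite enormN; lra.
have lay : linkable A a y.
  by case: hx => [<- //|hx]; apply: linkable_trans hx lxy => //; exact: ltW.
suff <- : y = b by [].
have : y <= c.
  apply: ub_le_sup; first by exists b.
  by split; [rewrite yb andbT (le_trans ax) ?ltW | right].
by rewrite /y; case: (leP b (c + r / 2)) => // _ h; exfalso; move: r2 h; lra.
Qed.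

End Fixed.
End Paths.

(** * Concatenating the links over the whole line *)

Section Lines.
Local Open Scope classical_set_scope.
Variables (R : realType) (n m : nat).
Implicit Types (A : R -> 'M[R]_n) (V : R -> 'M[R]_(n, m)) (s : 'I_m -> 'I_n).

Lemma half_line_path A s0 :
  (forall k : nat, linkable m A k%:R k.+1%:R) -> good_start A 0 s0 ->
  exists V, [/\ mx_path_continuous V, V 0 = sel_mx R s0 &
    forall t, 0 <= t -> is_comb (V t) /\ bounded_below (1 / 4) (A t) (V t)].
Proof.
move=> link g0.
(* Choice needs a total successor map; pairs that are not good starts receive a dummy path. *)
have /choice[next nextP] : forall ks : nat * ('I_m -> 'I_n), exists Vs : (R -> 'M[R]_(n, m)) * ('I_m -> 'I_n),
    good_start A ks.1%:R ks.2 -> good_path A ks.1%:R ks.1.+1%:R ks.2 Vs.1 Vs.2.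
  move=> [k s] /=; have [g|ng] := pselect (good_start A k%:R s).
    by have [V [s' h]] := link k s g; exists (V, s').
  by exists (fun=> 0, s).
pose fix st k := if k is j.+1 then (next (j, st j)).2 else s0.
pose P k := (next (k, st k)).1.
have gst k : good_start A k%:R (st k).
  by elim: k => [//|k IH]; have [] := nextP (k, st k) IH.
have gP k : good_path A k%:R k.+1%:R (st k) (P k) (st k.+1) := nextP (k, st k) (gst k).
(* [W k] follows the first [k] links and then rests at [st k]; each subtraction removes the value
   shared by consecutive pieces. *)
pose fix W (k : nat) (t : R) {struct k} := if k is j.+1 then W j t + P j t - sel_mx R (st j) else sel_mx R s0.
have cW k : mx_path_continuous (W k).
  elim: k => [|k IH]; first exact: mx_path_continuous_cst.
  apply: mx_path_continuousD; last exact: mx_path_continuous_cst.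
  by apply: mx_path_continuousD => //; have [] := gP k.
have W_right k t : k%:R <= t -> W k t = sel_mx R (st k).
  elim: k => [//|k IH] kt /=; have [_ [_ h] _ _] := gP k.
  by rewrite (h t kt) IH ?addrK 1?addrAC ?subrr ?add0r // (le_trans _ kt) ?ler_nat.
have W_stable k j t : t <= k%:R -> W (k + j)%N t = W k t.
  move=> tk; elim: j => [|j IH]; first by rewrite addn0.
  rewrite addnS /= IH; have [_ [h _] _ _] := gP (k + j)%N.
  by rewrite h ?addrK // (le_trans tk) // ler_nat leq_addr.
pose V t := W (Num.truncn t).+1 t.
have VE k t : t <= k%:R -> V t = W k t.
  move=> tk; have ts : t <= (Num.truncn t).+1%:R by exact/ltW/truncnS_gt.
  rewrite /V; case/orP: (leq_total k (Num.truncn t).+1) => /subnKC <-.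
    by rewrite W_stable.
  by rewrite W_stable.
exists V; split.
- apply: mx_path_continuous_locally => t.
  (* The integer [truncn t + 1] is strictly above [t], so one and the same [W] gives [V] on a
     neighbourhood of [t]. *)
  exists (W (Num.truncn t).+1) => //; near=> u; apply: VE.
  by near: u; apply: lt_le_nbhsl; exact: truncnS_gt.
- by rewrite (VE 0%N).
- move=> t t0; have /andP[h1 h2] := truncn_itv t0.
  rewrite /V /= W_right // addrAC subrr add0r.
  by have [_ _ h _] := gP (Num.truncn t); apply: h; rewrite h1 ltW.
Unshelve. all: by end_near. Qed.

(** The negative half line is handled by reversing time. Both half paths start from the same [s0],
    and at each time one of them is evaluated at 0, so they glue by addition. *)
Lemma comb_path_on_line A (L : R) : (0 < n)%N -> 512 * (m%:R * L) <= n%:R ->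
  mx_continuous A -> (forall t x, dotv (A t *m x) (A t *m x) <= L * dotv x x) ->
  (forall t i, dotv (col i (A t)) (col i (A t)) = 1) ->
  exists V, [/\ mx_path_continuous V &
    forall t, is_comb (V t) /\ bounded_below (1 / 4) (A t) (V t)].
Proof.
move=> n0 hm cA Ale Aun.
have cN : continuous (fun t : R => - t) by move=> t; apply: cvgN; exact: cvg_id.
pose B t := A (- t).
have cB : mx_continuous B by exact: (@mx_path_continuous_comp R n n A (fun t => - t)).
have [s0 g0] := good_start_exists n0 hm Ale Aun 0.
have gB : good_start B 0 s0 by rewrite /good_start /B oppr0.
have ltk (k : nat) : k%:R < k.+1%:R :> R by rewrite ltr_nat.
have [V [cV V0 hV]] := half_line_path (fun k => linkable_all n0 hm cA Ale Aun (ltk k)) g0.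
have [W [cW W0 hW]] := half_line_path
  (fun k => linkable_all n0 hm cB (fun t => Ale (- t)) (fun t => Aun (- t)) (ltk k)) gB.
have cpos : continuous ((fun=> 0 : R) \max (fun t : R => t)).
  by move=> t; apply: continuous_max; [exact: cvg_cst | exact: cvg_id].
have cneg : continuous ((fun=> 0 : R) \max (fun t : R => - t)).
  by move=> t; apply: continuous_max; [exact: cvg_cst | exact: cN].
exists (fun t => V (Num.max 0 t) + W (Num.max 0 (- t)) - sel_mx R s0); split.
  apply: mx_path_continuousD; last exact: mx_path_continuous_cst.
  apply: mx_path_continuousD; exact: mx_path_continuous_comp.
move=> t; have [t0|t0] := leP 0 t.
  by rewrite max_l ?oppr_le0 // W0 addrK; exact: hV.
rewrite max_r ?oppr_ge0 ?(ltW t0) // V0 addrAC subrr add0r.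
have : 0 <= - t by rewrite oppr_ge0 ltW.
by move=> /hW[]; rewrite /B opprK.
Qed.

End Lines.

(** * Column spaces and the operator norm *)

Section ColumnSpaces.
Variables (R : realType) (n m : nat).

Definition colspan (W : 'M[R]_(n, m)) : {vspace 'cV[R]_n} :=
  <<[seq col k W | k : 'I_m]>>%VS.

Lemma colspan_mul (W : 'M[R]_(n, m)) a : W *m a \in colspan W.
Proof.
rewrite mul_mx_sum; apply: memv_suml => k _; apply/memvZ/memv_span.
by apply: map_f; rewrite mem_enum.
Qed.

Lemma colspan_tuple (W : 'M[R]_(n, m)) : colspan W = <<[tuple col k W | k < m]>>%VS.
Proof. by []. Qed.

Lemma colspanP (W : 'M[R]_(n, m)) v : v \in colspan W -> exists a, v = W *m a.
Proof.
rewrite colspan_tuple => /coord_span vE.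
exists (\col_k coord [tuple col k W | k < m] k v); rewrite mul_mx_sum {1}vE.
by apply: eq_bigr => k _; rewrite -tnth_nth tnth_mktuple mxE.
Qed.

Lemma dim_colspan (W : 'M[R]_(n, m)) : W^T *m W = 1%:M -> \dim (colspan W) = m.
Proof.
move=> WW; rewrite colspan_tuple.
have /eqP -> : free [tuple col k W | k < m]; last by rewrite size_tuple.
apply/freeP => a h k.
have ah : W *m (\col_i a i) = 0.
  rewrite mul_mx_sum -[RHS]h; apply: eq_bigr => i _.
  by rewrite -tnth_nth tnth_mktuple mxE.
have : W^T *m (W *m (\col_i a i)) = 0 by rewrite ah mulmx0.
by rewrite mulmxA WW mul1mx => /colP /(_ k); rewrite !mxE.
Qed.

Lemma colspan_orth_proj (W : 'M[R]_(n, m)) : W^T *m W = 1%:M ->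
  is_orth_proj (colspan W) (W *m W^T).
Proof.
move=> WW v; split=> [|u /colspanP[a ->]]; first by rewrite -mulmxA colspan_mul.
rewrite dotv_mull mulmxBr !mulmxA WW mul1mx subrr; exact: dotv0r.
Qed.

Lemma mx_path_gram_continuous (V : R -> 'M[R]_(n, m)) : mx_path_continuous V ->
  mx_continuous (fun t => V t *m (V t)^T).
Proof.
move=> cV i j t.
rewrite (_ : (fun _ => _) = (fun t => \sum_k V t i k * V t j k)); last first.
  by apply/funext => u; rewrite mxE; apply: eq_bigr => k _; rewrite mxE.
apply: cvg_big => [|k _]; first exact: add_continuous.
by apply: cvgM; exact: cV.
Qed.

Lemma is_comb_quad (W : 'M[R]_(n, m)) : is_comb W -> quad_convex_comb m (colspan W).
Proof.
move=> [s1 [s2 [l [h1 h2 dj l01 ->]]]]; exists s1, s2, l; split=> //.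
congr (span _); apply: eq_map => k; apply/colP => i.
by rewrite !mxE !eqxx !andbT.
Qed.

Lemma is_comb_isometry (W : 'M[R]_(n, m)) : is_comb W -> W^T *m W = 1%:M.
Proof.
by move=> [s1 [s2 [l [/homo_lt_inj i1 /homo_lt_inj i2 dj l01 ->]]]]; exact: comb_mx_orth.
Qed.

(** The conclusion of the theorem with a free lower bound [y] for the dimension, shared by its three
    cases. The projections [V t *m (V t)^T] are continuous with [V]. *)
Lemma colspan_family (A : R -> 'M[R]_n) (V : R -> 'M[R]_(n, m)) (c : R) (y : \bar R) :
  mx_path_continuous V -> (forall t, (V t)^T *m V t = 1%:M) ->
  (forall t, bounded_below c (A t) (V t)) -> (n != 1%N -> forall t, is_comb (V t)) ->
  (y <= m%:R%:E)%E ->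
  exists (m : nat) (U : R -> {vspace 'cV[R]_n}),
        [/\ continuous_family U,
            (forall t : R, \dim (U t) = m),
            (y <= m%:R%:E)%E,
            (forall (t : R) (v : 'cV[R]_n),
               v \in U t -> c * enorm v <= enorm (A t *m v))
          & (n != 1)%N -> forall t : R, quad_convex_comb m (U t)].
Proof.
move=> cV iV bV qV ym; exists m, (fun t => colspan (V t)); split=> //.
- exists (fun t => V t *m (V t)^T); split; last exact: mx_path_gram_continuous.
  by move=> t; exact: colspan_orth_proj.
- by move=> t; exact: dim_colspan.
- move=> t v /colspanP[a ->]; rewrite isometry_enorm //; exact: bV.
- by move=> n1 t; apply/is_comb_quad/qV.
Qed.

End ColumnSpaces.

(** * The operator norm as a bound *)

Section OperatorNorm.
Local Open Scope classical_set_scope.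
Variables (R : realType) (n : nat).

(** The Frobenius norm bounds the set, so [opnorm] is a true supremum and not the default value of
    [sup]. *)
Lemma opnorm_has_sup (B : 'M[R]_n) :
  has_sup [set enorm (B *m v) | v in [set v : 'cV[R]_n | enorm v <= 1]].
Proof.
split; first by exists (enorm (B *m 0)), 0 => //=; rewrite /enorm dotv0l sqrtr0 ler01.
exists (Num.sqrt (\sum_i \sum_j B i j ^+ 2)) => _ [v /= v1 <-].
rewrite ler_wsqrtr //; apply: le_trans (mulmx_frobenius B v) _.
rewrite ler_piMr //; last first.
  by rewrite -enorm_sqr exprn_ile1 // enorm_ge0.
by apply: sumr_ge0 => i _; apply: sumr_ge0 => j _; exact: sqr_ge0.
Qed.

Lemma le_opnorm (B : 'M[R]_n) v : enorm v <= 1 -> enorm (B *m v) <= opnorm B.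
Proof.
move=> v1; apply: ub_le_sup; first by have [] := opnorm_has_sup B.
by exists v.
Qed.

Lemma enorm_mulmx_le (B : 'M[R]_n) v : enorm (B *m v) <= opnorm B * enorm v.
Proof.
have [->|v0] := eqVneq v 0; first by rewrite mulmx0 /enorm dotv0l sqrtr0 mulr0.
have vp : 0 < enorm v by rewrite sqrtr_gt0 dotv_gt0.
have := @le_opnorm B ((enorm v)^-1 *: v).
rewrite -scalemxAr !enormZ ger0_norm ?invr_ge0 ?enorm_ge0 // mulVf ?gt_eqF // lexx.
by rewrite ler_pdivrMl // mulrC; apply.
Qed.

End OperatorNorm.

(** * Consequences of unit columns and the degenerate dimensions *)

Section Reduction.
Variables (R : realType) (n : nat) (A : R -> 'M[R]_n).
Hypothesis A_unit : forall t i, enorm (A t *m basis_vec R i) = 1.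

Lemma unit_col t i : dotv (col i (A t)) (col i (A t)) = 1.
Proof. by rewrite colE -enorm_sqr -/(basis_vec R i) A_unit expr1n. Qed.

Lemma enorm_basis i : enorm (basis_vec R i : 'cV[R]_n) = 1.
Proof.
rewrite /enorm /dotv (bigD1 i) //= !mxE !eqxx mulr1 big1 ?addr0 ?sqrtr1 // => j /negPf ji.
by rewrite !mxE ji mul0r.
Qed.

Lemma opnorm_ge1 t : (0 < n)%N -> 1 <= opnorm (A t).
Proof.
move=> n0; rewrite -(A_unit t (Ordinal n0)).
by apply: le_opnorm; rewrite enorm_basis.
Qed.

Lemma is_comb_width0 (W : 'M[R]_(n, 0)) : is_comb W.
Proof.
have f : 'I_0 -> 'I_n by case.
exists f, f, 0; split; try by case.
  by rewrite lexx ler01.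
by apply/matrixP => i [].
Qed.

Lemma bounded_below_line t s : bounded_below (1 / 4) (A t) (sel_mx R s : 'M[R]_(n, 1)).
Proof.
move=> a; rewrite mul_sel_sum big_ord1 enormZ colE A_unit mulr1.
have -> : enorm a = `|a 0 0|.
  by rewrite /enorm /dotv big_ord1 -expr2 sqrtr_sqr.
by have := normr_ge0 (a 0 0); lra.
Qed.

Lemma sup_opnorm_finite (x : R) t : sup_opnorm A = x%:E -> opnorm (A t) <= x.
Proof.
by move=> E; rewrite -lee_fin -E; apply: ereal_sup_ubound; exists t.
Qed.

End Reduction.

(** Take [m] the integer part of [a / b]: it is at least 1, so [a / b < m + 1 <= 2 m]. *)
Lemma exists_multiple_between (R : realType) (a b : R) : 0 < b -> b <= a ->
  exists2 m : nat, m%:R * b <= a & a <= 2 * (m%:R * b).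
Proof.
move=> b0 ba; have y1 : 1 <= a / b by rewrite ler_pdivlMr ?mul1r.
have /andP[lo hi] := truncn_itv (le_trans ler01 y1).
exists (Num.truncn (a / b)); first by rewrite -ler_pdivlMr.
have m1 : 1 <= (Num.truncn (a / b))%:R :> R by rewrite ler1n truncn_gt_nat.
rewrite mulrA -ler_pdivrMr //; apply: le_trans (ltW hi) _.
by rewrite -natr1; lra.
Qed.

(** The construction yields a bound in [n / x ^+ 2], which implies the one in [n / x ^+ 4] because
    [x >= 1]. *)
Lemma dimension_bound (R : realType) (n m : nat) (x : R) : 1 <= x ->
  n%:R <= 1024 * (m%:R * x ^+ 2) ->
  ((1 / 1024 * n%:R)%:E / x%:E ^+ 4 <= m%:R%:E)%E.
Proof.
move=> x1 h; have x4 : 0 < x ^+ 4 by rewrite exprn_gt0 //; lra.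
rewrite -EFin_expe inver gt_eqF // -EFinM lee_fin ler_pdivrMr //.
have : m%:R * x ^+ 2 <= m%:R * x ^+ 4 by rewrite ler_wpM2l // ler_weXn2l.
lra.
Qed.

Theorem theorem1p4 (R : realType) :
  exists c d : R, [/\ 0 < c, 0 < d &
    forall (n : nat) (A : R -> 'M[R]_n),
      mx_continuous A ->
      (forall (t : R) (i : 'I_n), enorm (A t *m basis_vec R i) = 1) ->
      exists (m : nat) (U : R -> {vspace 'cV[R]_n}),
        [/\ continuous_family U,
            (forall t : R, \dim (U t) = m),
            ((d * n%:R)%:E / sup_opnorm A ^+ 4 <= m%:R%:E)%E,
            (forall (t : R) (v : 'cV[R]_n),
               v \in U t -> c * enorm v <= enorm (A t *m v))
          & (n != 1)%N -> forall t : R, quad_convex_comb m (U t)]].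
Proof.
(* 1/4 is the bound kept along the paths; 1024 is the 512 of the selection times the factor 2 lost
   in rounding [m]. *)
exists (1 / 4), (1 / 1024); split; [lra | lra |] => n A cA A_unit.
(* If [n = 0] or the supremum is infinite, the required dimension is at most 0 (the extended
   quotient is then 0) and zero subspaces suffice. *)
have [le0|[n0 [x SE]]] : ((1 / 1024 * n%:R)%:E / sup_opnorm A ^+ 4 <= 0)%E \/
    (0 < n)%N /\ exists x, sup_opnorm A = x%:E.
- have [n0|n0] := posnP n.
    have nR : n%:R = 0 :> R by rewrite n0.
    by left; rewrite nR mulr0 mul0e.
  have : (1 <= sup_opnorm A)%E.
    apply: le_trans (_ : (opnorm (A 0))%:E <= _)%E.
      by rewrite lee_fin opnorm_ge1.
    by apply: ereal_sup_ubound; exists 0.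
  case: (sup_opnorm A) => [x||] h; [by right; split=> //; exists x | | by []].
  by left; rewrite !expeS expe0 mule1 !mulyy invey mule0.
- apply: (@colspan_family _ n 0 A (fun=> 0)) => //.
  + exact: mx_path_continuous_cst.
  + by move=> t; apply/matrixP => -[].
  + by move=> t a; rewrite mul0mx mulmx0 [a]flatmx0 /enorm !dotv0l sqrtr0 mulr0.
  + by move=> _ t; exact: is_comb_width0.
have A_opnorm t : opnorm (A t) <= x := sup_opnorm_finite t SE.
have x1 : 1 <= x := le_trans (opnorm_ge1 A_unit 0 n0) (A_opnorm 0).
have L1 : 1 <= x ^+ 2 by rewrite exprn_ege1.
have A_le t v : dotv (A t *m v) (A t *m v) <= x ^+ 2 * dotv v v.
  rewrite -enorm_le; last by lra.
  by apply: le_trans (enorm_mulmx_le _ _) _; rewrite ler_wpM2r ?enorm_ge0.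
rewrite SE.
have [big|small] := leP (512 * x ^+ 2) n%:R.
  have L512 : 0 < 512 * x ^+ 2 by lra.
  have [m mlo mhi] := exists_multiple_between L512 big.
  have hm : 512 * (m%:R * x ^+ 2) <= n%:R by lra.
  have [V [cV hV]] := comb_path_on_line n0 hm cA A_le (unit_col A_unit).
  apply: (@colspan_family _ n m A V) => //.
  - by move=> t; apply: is_comb_isometry; have [] := hV t.
  - by move=> t; have [] := hV t.
  - by move=> _ t; have [] := hV t.
  - by apply: dimension_bound => //; lra.
(* Now [n < 512 x^2], so dimension 1 is enough, and the line of the first basis vector works at all
   times because the columns are unit vectors. *)
pose s (_ : 'I_1) := Ordinal n0.
have sh : {homo s : k l / (k < l)%N} by move=> k l; rewrite (ord1 k) (ord1 l) ltnn.
apply: (@colspan_family _ n 1 A (fun=> sel_mx R s)) => //.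
- exact: mx_path_continuous_cst.
- by move=> t; exact: sel_mx_isometry.
- by move=> t; exact: bounded_below_line.
- move=> n1 _; have n2 : (1 < n)%N by case: n n0 n1 {A cA A_unit SE A_opnorm A_le small s sh} => [|[]].
  (* With [lambda = 1] the combination is the first basis vector; the disjoint second index exists
     because [n > 1]. *)
  exists s, (fun=> Ordinal n2), 1; split=> //; first by rewrite ler01 lexx.
  by rewrite comb_mx1.
- apply: dimension_bound => //; rewrite mul1r; lra.
Qed.
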